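(* Let $m,b,r,s,s',t,t'$ be positive integers with $s'\geq s\geq \max\{r,2m+1\}$, $m\leq \min\{b,r-1\}$, $t'\geq t\geq \lceil s/m\rceil$ and $t'\geq \lceil s'/m\rceil$. Then there exists a graph $G$ such that $\gamma(G)=r$, $s_{MB}(G,m:b)=s$, $\gamma_{MB}(G,m:b)=t$, $s'_{MB}(G,m:b)=s'$ and $\gamma'_{MB}(G,m:b)=t'$.
   Context: $\gamma(G)$ denotes the domination number of $G$. The $(m:b)$ Maker-Breaker domination game on a graph $G$ is played by Dominator and Staller on $V(G)$: they alternate moves, Dominator claiming up to $m$ unclaimed vertices per move and Staller up to $b$ unclaimed vertices per move; Dominator wins if she claims all vertices of some dominating set of $G$, Staller wins otherwise. $\gamma_{MB}(G,m:b)$ is the smallest number of rounds within which Dominator can always win when she starts the game ($\infty$ if she has no winning strategy), and $\gamma'_{MB}(G,m:b)$ is the same when Staller starts. $s_{MB}(G,m:b)$ is the smallest size of a dominating set that Dominator can always claim when she starts the game ($\infty$ if she cannot win), and $s'_{MB}(G,m:b)$ is the same when Staller starts. *)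

(* Defs.v *)
From mathcomp Require Import all_boot.
From mathcomp Require Import boolp.
Set Implicit Arguments.
Unset Strict Implicit.
Unset Printing Implicit Defensive.

Record sgraph := SGraph {
  vertex :> finType;
  adj : rel vertex;
  adj_sym : symmetric adj;
  adj_irrefl : irreflexive adj }.

Definition dominating (G : sgraph) (D : {set G}) : bool :=
  [forall v : G, (v \in D) || [exists u in D, adj u v]].

(* The whole vertex set, which is dominating, seeds the minimization. *)
Definition domination_number (G : sgraph) : nat :=
  #|[arg min_(D < [set: G] | dominating D) #|D|]|.

(* A position is a pair (D, S): the vertices claimed so far by Dominator and by
   Staller.  Claiming "up to k" vertices includes claiming none; in particular a
   player still has a (void) move when the board is full. *)
Definition legal_move (V : finType) (k : nat) (D S X : {set V}) : bool :=
  (X \subset ~: (D :|: S)) && (#|X| <= k).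

(* Dominator, who is to move, can make the set of her claimed vertices satisfy
   [goal] using at most n of her own moves.  The reply of Staller to the last of
   these moves is harmless, as it does not change Dominator's set. *)
Fixpoint dom_forces (V : finType) (goal : {set V} -> Prop) (m b n : nat)
    (D S : {set V}) : Prop :=
  goal D \/
  if n is n'.+1 then
    exists2 X : {set V}, legal_move m D S X &
      forall Y : {set V}, legal_move b (D :|: X) S Y ->
        dom_forces goal m b n' (D :|: X) (S :|: Y)
  else False.

(* A round consists of one move of each player, so that in both versions of the
   game n rounds contain n moves of Dominator. *)
Definition forces_dstart (V : finType) (goal : {set V} -> Prop) (m b n : nat)
    : Prop :=
  dom_forces goal m b n set0 set0.

Definition forces_sstart (V : finType) (goal : {set V} -> Prop) (m b n : nat)
    : Prop :=
  forall Y : {set V}, legal_move b set0 set0 Y -> dom_forces goal m b n set0 Y.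

Definition claims_dom (G : sgraph) (A : {set G}) : Prop :=
  exists D : {set G}, dominating D /\ D \subset A.

(* Only the dominating set itself is measured: Dominator may have claimed other
   vertices as well. *)
Definition claims_dom_le (G : sgraph) (k : nat) (A : {set G}) : Prop :=
  exists D : {set G}, [/\ dominating D, D \subset A & #|D| <= k].

(* Least natural number satisfying P; None stands for infinity. *)
Definition least (P : nat -> Prop) : option nat :=
  if pselect (exists n, `[< P n >]) is left exP then Some (ex_minn exP)
  else None.

Definition gammaMB (G : sgraph) (m b : nat) : option nat :=
  least (fun n => forces_dstart (@claims_dom G) m b n).

Definition gammaMB' (G : sgraph) (m b : nat) : option nat :=
  least (fun n => forces_sstart (@claims_dom G) m b n).

(* No bound is imposed on the number of rounds. *)
Definition sMB (G : sgraph) (m b : nat) : option nat :=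
  least (fun k => exists n, forces_dstart (@claims_dom_le G k) m b n).

Definition sMB' (G : sgraph) (m b : nat) : option nat :=
  least (fun k => exists n, forces_sstart (@claims_dom_le G k) m b n).

(* The ceiling of a / d, for 0 < d. *)
Definition ceil_div (a d : nat) : nat := (a + d.-1) %/ d.

(* Main.v *)
(* Any monotone family of winning subsets of a finite set A is the family of
   dominating sets of a graph in which A is a clique and every set that must
   be met has many test vertices attached to it; so it suffices to design a
   Maker-Breaker game won by Dominator as Maker. The board consists of
   components made of b + 1 cycles through a common root; the sites of a
   cycle are blocks of m cells, and between neighbouring sites lie b guard
   cells. A set wins if it contains two neighbouring blocks, a guard between
   them and enough cells of a large common pool; moreover the root of
   component 0 and r - m extra cells form a small winning set.

   Dominator claims an untouched root and turns to an untouched cycle, that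
   is, a segment both of whose ends are hers. A further block splits a
   segment in two, and Staller can cut only one part: both halves matter if
   b = 1, while for b > 1 a part is dangerous only if it has length 1, as
   cutting it takes all b cells of Staller's move, whereas longer parts cost
   one cell each. So the length of the cycles (2^k or k + 1) fixes the
   number k of block moves needed, and the pool fixes the number of other
   moves. Component 0 realises (s, t), the others (s', t'); if Staller
   starts, one cell of the root of component 0 destroys both that component
   and the small winning set. *)
Require Import Defs.
From HB Require Import structures.
From mathcomp Require Import all_boot.
From mathcomp Require Import boolp zify.

Set Implicit Arguments.
Unset Strict Implicit.
Unset Printing Implicit Defensive.

Lemma dom_forces_impl (V : finType) (goal goal' : {set V} -> Prop) m b n
    (D S : {set V}) :
  (forall D' : {set V}, #|D'| <= #|D| + m * n -> goal D' -> goal' D') ->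
  dom_forces goal m b n D S -> dom_forces goal' m b n D S.
Proof.
elim: n D S => [|n IHn] D S imp /=.
  by case=> // gD; left; apply: imp => //; rewrite leq_addr.
case=> [gD|[X lX forced]]; first by left; apply: imp => //; rewrite leq_addr.
right; exists X => // Y lY; apply: IHn (forced Y lY) => D' leD'.
case/andP: lX => _ leX; apply: imp; apply: leq_trans leD' _.
rewrite mulnS addnA leq_add2r; have [+ _] := leq_card_setU D X; lia.
Qed.

Lemma not_dom_forces (V : finType) (goal : {set V} -> Prop) m b
    (inv : nat -> {set V} -> {set V} -> Prop) N :
  (forall j D S, inv j D S -> j <= N -> ~ goal D) ->
  (forall j D S X, inv j D S -> legal_move m D S X ->
     exists2 Y, legal_move b (D :|: X) S Y & inv j.+1 (D :|: X) (S :|: Y)) ->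
  forall n j D S, inv j D S -> j + n <= N -> ~ dom_forces goal m b n D S.
Proof.
move=> safe step; elim=> [|n IHn] j D S iDS le_jn /=.
  by case=> // gD; apply: safe iDS _ gD; lia.
case=> [gD|[X lX forced]]; first by apply: safe iDS _ gD; lia.
have [Y lY iY] := step _ _ _ _ iDS lX.
by apply: IHn iY _ (forced Y lY); lia.
Qed.

Lemma dom_forces_preim (A V : finType) (f : A -> V)
    (goal : {set A} -> Prop) m b n (D S : {set V}) :
  injective f ->
  dom_forces (fun D' => goal (f @^-1: D')) m b n D S <->
  dom_forces goal m b n (f @^-1: D) (f @^-1: S).
Proof.
move=> inj_f.
have pre_im (X : {set A}) : f @^-1: (f @: X) = X.
  by apply/setP=> a; rewrite inE mem_imset.
have le_pre (X : {set V}) : #|f @^-1: X| <= #|X|.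
  rewrite -(card_imset _ inj_f); apply/subset_leq_card/subsetP=> v.
  by case/imsetP=> a; rewrite inE => aX ->.
have legal_pre k (D' S' X : {set V}) : legal_move k D' S' X ->
    legal_move k (f @^-1: D') (f @^-1: S') (f @^-1: X).
  case/andP=> /subsetP sX leX; apply/andP; split; last exact: leq_trans leX.
  by apply/subsetP=> a; rewrite !inE => /sX; rewrite !inE.
have legal_im k (D' S' : {set V}) (X : {set A}) :
    legal_move k (f @^-1: D') (f @^-1: S') X -> legal_move k D' S' (f @: X).
  case/andP=> /subsetP sX leX; apply/andP; split; last by rewrite card_imset.
  by apply/subsetP=> v /imsetP[a aX ->]; have := sX _ aX; rewrite !inE.
elim: n D S => [|n IHn] D S //=; split=> -[gD|[X lX forced]]; try by left.
- right; exists (f @^-1: X); first exact: legal_pre.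
  move=> Y; rewrite -preimsetU => /legal_im lY; rewrite -[Y]pre_im -preimsetU.
  exact/IHn/forced.
- right; exists (f @: X); first exact: legal_im.
  move=> Y /legal_pre lY; apply/IHn; rewrite !preimsetU pre_im; apply: forced.
  by move: lY; rewrite preimsetU pre_im.
Qed.

Definition claims_small (A : finType) (win : {set A} -> bool) (k : nat)
    (D : {set A}) : Prop :=
  exists W : {set A}, [/\ win W, W \subset D & #|W| <= k].

Lemma least_eq (P : nat -> Prop) k :
  P k -> (forall n, n < k -> ~ P n) -> least P = Some k.
Proof.
move=> Pk minP; rewrite /least; case: pselect => [exP|]; last first.
  by case; exists k; apply/asboolP.
case: ex_minnP => n /asboolP Pn min_n; congr Some.
have le_nk : n <= k by apply: min_n; apply/asboolP.
by case: (ltnP n k) => [/minP//|]; lia.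
Qed.

(** * Realising monotone families by dominating sets *)

Section Realisation.

Variables (A : finType) (win : {set A} -> bool) (k : nat).
Hypothesis win_mono : forall W W' : {set A}, W \subset W' -> win W -> win W'.
Hypothesis not_win0 : ~~ win set0.

(* The vertex [inr (T, i)] tests whether a set meets T; this is required only
   of those T whose complement is not winning, and these T suffice to recognise
   the winning sets. The k copies make it useless to claim test vertices. *)
Definition test_adj (u v : A + {set A} * 'I_k) : bool :=
  match u, v with
  | inl a, inl a' => a != a'
  | inl a, inr (T, _) | inr (T, _), inl a => win (~: T) || (a \in T)
  | inr _, inr _ => false
  end.

Lemma test_adj_sym : symmetric test_adj.
Proof. by move=> [a|[T i]] [a'|[T' i']] //=; rewrite eq_sym. Qed.

Lemma test_adj_irrefl : irreflexive test_adj.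
Proof. by move=> [a|[T i]] //=; rewrite eqxx. Qed.

Definition test_graph : sgraph := SGraph test_adj_sym test_adj_irrefl.

Definition core (a : A) : test_graph := inl a.

Lemma core_inj : injective core.
Proof. by move=> a a' []. Qed.

Lemma win_dominating (D : {set test_graph}) :
  win (core @^-1: D) -> dominating D.
Proof.
move=> winD; have [a aD] : exists a, a \in core @^-1: D.
  by apply/set0Pn; apply: contraNneq not_win0 => <-.
apply/forallP=> -[a'|[T i]]; apply/orP.
  have [eq_aa'|neq] := eqVneq a a'; first by left; move: aD; rewrite inE eq_aa'.
  by right; apply/existsP; exists (core a); rewrite inE in aD; rewrite aD.
right; apply/existsP; case: (boolP (win (~: T))) => [wT|nwT].
  by exists (core a); rewrite inE in aD; rewrite aD /= wT.
have [a' a'T] : exists a', a' \in T :&: (core @^-1: D).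
  apply/set0Pn; apply: contraNneq nwT => T0; apply: win_mono winD.
  by rewrite subsetC -disjoints_subset -setI_eq0 T0.
by move: a'T; rewrite 2!inE => /andP[a'T a'D]; exists (core a'); rewrite a'D /= a'T orbT.
Qed.

Lemma dominating_win (D : {set test_graph}) :
  #|D| < k -> dominating D -> win (core @^-1: D).
Proof.
move=> ltDk domD; apply: contraTT ltDk => nwin; rewrite -leqNgt.
set T := ~: (core @^-1: D).
pose test (i : 'I_k) : test_graph := inr (T, i).
have inj_test : injective test by move=> i i' [].
rewrite -[k]card_ord -(card_imset _ inj_test).
apply/subset_leq_card/subsetP=> _ /imsetP[i _ ->].
have /orP[//|/existsP[[a|[T' i']] /andP[aD]]] := forallP domD (test i) => //=.
by rewrite setCK (negPf nwin) !inE /= => /negP[].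
Qed.

Lemma claims_dom_core (D : {set test_graph}) : #|D| < k ->
  claims_dom D <-> win (core @^-1: D).
Proof.
move=> ltDk; split=> [[D' [domD' sD'D]]|wD]; last first.
  by exists D; split=> //; apply: win_dominating.
apply: win_mono (preimsetS _ sD'D) _; apply: dominating_win => //.
exact: leq_ltn_trans (subset_leq_card sD'D) ltDk.
Qed.

Lemma core_imK (W : {set A}) : core @^-1: (core @: W) = W.
Proof. by apply/setP=> a; rewrite inE mem_imset //; apply: core_inj. Qed.

Lemma claims_dom_le_core l (D : {set test_graph}) : l < k ->
  claims_dom_le l D <-> claims_small win l (core @^-1: D).
Proof.
move=> ltlk; split=> [[D' [domD' sD'D leD']]|[W [wW sWD leW]]].
  exists (core @^-1: D'); split; [|exact: preimsetS|].
    by apply: dominating_win => //; lia.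
  apply: leq_trans leD'; rewrite -(card_imset _ core_inj).
  by apply/subset_leq_card/subsetP=> _ /imsetP[a aD ->]; rewrite inE in aD.
exists (core @: W); split; last by rewrite card_imset //; apply: core_inj.
  by apply: win_dominating; rewrite core_imK.
by apply/subsetP=> _ /imsetP[a /(subsetP sWD) aD ->]; rewrite inE in aD.
Qed.

Lemma domination_number_core r (W0 : {set A}) : r <= k ->
  win W0 -> #|W0| = r -> (forall W : {set A}, win W -> r <= #|W|) ->
  domination_number test_graph = r.
Proof.
move=> le_rk wW0 card_W0 min_r; rewrite /domination_number.
case: arg_minnP => [|D domD minD].
  by apply: win_dominating; apply: win_mono wW0; apply/subsetP=> a _; rewrite !inE.
apply/eqP; rewrite eqn_leq -{1}card_W0 -(card_imset _ core_inj) minD /=; last first.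
  by apply: win_dominating; rewrite core_imK.
case: (ltnP #|D| k) => [ltDk|]; last exact: leq_trans.
apply: leq_trans (min_r _ (dominating_win ltDk domD)) _.
rewrite -(card_imset _ core_inj); apply/subset_leq_card/subsetP=> _ /imsetP[a aD ->].
by rewrite inE in aD.
Qed.

Lemma dstart_core (goal : {set A} -> Prop) (goal' : {set test_graph} -> Prop) m b n :
  (forall D : {set test_graph}, #|D| <= m * n -> goal' D <-> goal (core @^-1: D)) ->
  forces_dstart goal' m b n <-> forces_dstart goal m b n.
Proof.
move=> goalE; have := dom_forces_preim goal m b n set0 set0 core_inj.
rewrite !preimset0 -/(forces_dstart goal m b n) => <-.
by split; apply: dom_forces_impl => D; rewrite cards0 => /goalE[].
Qed.

Lemma sstart_core (goal : {set A} -> Prop) (goal' : {set test_graph} -> Prop) m b n :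
  (forall D : {set test_graph}, #|D| <= m * n -> goal' D <-> goal (core @^-1: D)) ->
  forces_sstart goal' m b n <-> forces_sstart goal m b n.
Proof.
move=> goalE.
have forcesE Y : dom_forces goal' m b n set0 Y <->
    dom_forces goal m b n set0 (core @^-1: Y).
  have := dom_forces_preim goal m b n set0 Y core_inj.
  rewrite !preimset0 => <-.
  by split; apply: dom_forces_impl => D; rewrite cards0 => /goalE[].
have legalE c (X : {set test_graph}) : legal_move c set0 set0 X = (#|X| <= c).
  by rewrite /legal_move setU0 setC0 subsetT.
have legalEA c (X : {set A}) : legal_move c set0 set0 X = (#|X| <= c).
  by rewrite /legal_move setU0 setC0 subsetT.
split=> forced Y.
  rewrite legalEA => leY; rewrite -(core_imK Y); apply/forcesE/forced.
  by rewrite legalE card_imset //; apply: core_inj.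
rewrite legalE => leY; apply/forcesE/forced; rewrite legalEA; apply: leq_trans leY.
rewrite -(card_imset _ core_inj); apply/subset_leq_card/subsetP=> _ /imsetP[a aD ->].
by rewrite inE in aD.
Qed.

End Realisation.

Lemma realise_game (A : finType) (win : {set A} -> bool) m b r s s' t t' :
  (forall W W' : {set A}, W \subset W' -> win W -> win W') ->
  0 < r -> (exists2 W, win W & #|W| = r) -> (forall W : {set A}, win W -> r <= #|W|) ->
  forces_dstart (claims_small win s) m b t ->
  forces_sstart (claims_small win s') m b t' ->
  (forall n l, l < s -> ~ forces_dstart (claims_small win l) m b n) ->
  (forall n l, l < s' -> ~ forces_sstart (claims_small win l) m b n) ->
  (forall n, n < t -> ~ forces_dstart (fun D => win D) m b n) ->
  (forall n, n < t' -> ~ forces_sstart (fun D => win D) m b n) ->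
  exists G : sgraph,
    [/\ domination_number G = r,
        sMB G m b = Some s,
        gammaMB G m b = Some t,
        sMB' G m b = Some s' &
        gammaMB' G m b = Some t'].
Proof.
move=> mono r_gt0 [W0 wW0 cardW0] minr ds ss lds lss ldt lst.
have nw0 : ~~ win set0 by apply/negP=> /minr; rewrite cards0; lia.
have small_win D l : claims_small win l D -> win D.
  by case=> W [wW sWD _]; apply: mono wW.
pose k := (r + s + s' + m * t + m * t').+1.
have timeE n : n <= t \/ n <= t' -> forall D : {set test_graph win k}, #|D| <= m * n ->
    claims_dom D <-> (fun D => win D) (core win k @^-1: D).
  move=> len D leD; apply: claims_dom_core => //; apply: leq_ltn_trans leD _.
  rewrite /k ltnS; case: len => len; have := leq_mul (leqnn m) len; lia.
have sizeE l n : l <= s \/ l <= s' -> forall D : {set test_graph win k}, #|D| <= m * n ->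
    claims_dom_le l D <-> claims_small win l (core win k @^-1: D).
  by move=> lel D _; apply: claims_dom_le_core => //; rewrite /k; lia.
exists (test_graph win k); split.
- by apply: (domination_number_core mono nw0 _ wW0) => //; rewrite /k; lia.
- apply: least_eq => [|l lt_ls [n]].
    by exists t; apply/(dstart_core _ (sizeE _ _ _)) => //; left.
  by move/(dstart_core _ (sizeE _ _ (or_introl (ltnW lt_ls)))); apply: lds.
- apply: least_eq => [|n lt_nt].
    apply/(dstart_core (goal := fun W => win W) _ (timeE _ _)); first by left.
    by apply: dom_forces_impl ds => D _; apply: small_win.
  by move/(dstart_core (goal := fun W => win W) _ (timeE _ (or_introl (ltnW lt_nt)))); apply: ldt.
- apply: least_eq => [|l lt_ls [n]].
    by exists t'; apply/(sstart_core _ (sizeE _ _ _)) => //; right.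
  by move/(sstart_core _ (sizeE _ _ (or_intror (ltnW lt_ls)))); apply: lss.
- apply: least_eq => [|n lt_nt].
    apply/(sstart_core (goal := fun W => win W) _ (timeE _ _)); first by right.
    by move=> Y /ss; apply: dom_forces_impl => D _; apply: small_win.
  by move/(sstart_core (goal := fun W => win W) _ (timeE _ (or_intror (ltnW lt_nt)))); apply: lst.
Qed.

(** * The board *)

Definition meets (T : finType) (A B : {set T}) : bool := A :&: B != set0.

Lemma meetsP (T : finType) (A B : {set T}) :
  reflect (exists2 c, c \in A & c \in B) (meets A B).
Proof.
rewrite /meets; apply: (iffP (set0Pn _)) => [[c]|[c cA cB]]; last by exists c; rewrite inE cA.
by rewrite inE => /andP[]; exists c.
Qed.

Lemma meetsS (T : finType) (A B B' : {set T}) :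
  B \subset B' -> meets A B -> meets A B'.
Proof. by move=> /subsetP sBB' /meetsP[c cA /sBB' cB']; apply/meetsP; exists c. Qed.

Lemma meetsSl (T : finType) (A A' B : {set T}) :
  A \subset A' -> meets A B -> meets A' B.
Proof. by move=> /subsetP sAA' /meetsP[c /sAA' cA cB]; apply/meetsP; exists c. Qed.

Section Board.

Variables (m b P z e : nat) (L zeta : 'I_b.+2 -> nat).

Definition site : Type := ('I_b.+2 * 'I_b.+1 * 'I_P.+1)%type.
Definition cell : Type := ((site * 'I_m + site * 'I_b) + ('I_z + 'I_e))%type.
HB.instance Definition _ := Finite.on site.
HB.instance Definition _ := Finite.on cell.

Definition label (c : cell) : site + site + bool :=
  match c with
  | inl (inl (v, _)) => inl (inl v)
  | inl (inr (w, _)) => inl (inr w)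
  | inr (inl _) => inr true
  | inr (inr _) => inr false
  end.

Definition blk (v : site) : {set cell} := [set c | label c == inl (inl v)].
Definition grd (w : site) : {set cell} := [set c | label c == inl (inr w)].
Definition pool : {set cell} := [set c | label c == inr true].
Definition extra : {set cell} := [set c | label c == inr false].
Definition loose : {set cell} :=
  [set c | match label c with inl (inr _) | inr true => true | _ => false end].

(* Positions 0 and L x of every cycle y of component x are the same site. *)
Definition root (x : 'I_b.+2) : site := (x, ord0, ord0).
Definition edge (x : 'I_b.+2) (y : 'I_b.+1) (i : nat) : site := (x, y, inord i).
Definition node (x : 'I_b.+2) (y : 'I_b.+1) (i : nat) : site :=
  if (i == 0) || (i == L x) then root x else edge x y i.

Definition small_set : {set cell} := blk (root ord0) :|: extra.

Definition linked (M : {set cell}) x y i : bool :=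
  [&& i < L x, blk (node x y i) \subset M, blk (node x y i.+1) \subset M
    & meets (grd (edge x y i)) M].

Definition win (M : {set cell}) : bool :=
  (small_set \subset M) ||
  [exists x, exists y, exists i : 'I_P.+1,
     linked M x y i && (zeta x <= #|M :&: pool|)].

Hypotheses (m_gt0 : 0 < m) (le_mb : m <= b) (e_gt0 : 0 < e).
Hypotheses (L_gt1 : forall x, 1 < L x) (L_leP : forall x, L x <= P).

Let b_gt0 : 0 < b. Proof. exact: leq_trans le_mb. Qed.

Lemma winP (M : {set cell}) :
  reflect (small_set \subset M \/
           exists x y i, linked M x y i /\ zeta x <= #|M :&: pool|) (win M).
Proof.
apply: (iffP orP) => -[|h]; try by left.
  by right; have /existsP[x /existsP[y /existsP[i /andP[]]]] := h; exists x, y, i.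
right; have [x [y [i [lnk ge]]]] := h; have /and4P[ltiL _ _ _] := lnk.
have ltiP : i < P.+1 by have := L_leP x; lia.
apply/existsP; exists x; apply/existsP; exists y; apply/existsP.
by exists (Ordinal ltiP); rewrite /= lnk.
Qed.

Lemma win_mono (W W' : {set cell}) : W \subset W' -> win W -> win W'.
Proof.
move=> sWW' /winP[sW|[x [y [i [/and4P[ltiL o1 o2 g] ge]]]]]; apply/winP.
  by left; apply: subset_trans sWW'.
right; exists x, y, i; split; last exact: leq_trans ge (subset_leq_card (setSI _ sWW')).
by apply/and4P; split=> //; [apply: subset_trans sWW'|apply: subset_trans sWW'|apply: meetsS g].
Qed.

Lemma card_blk v : #|blk v| = m.
Proof.
pose f (j : 'I_m) : cell := inl (inl (v, j)).
rewrite -[RHS]card_ord -(card_imset _ (_ : injective f)); last by move=> ? ? [].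
congr #|pred_of_set _|; apply/setP=> c; rewrite inE; apply/eqP/imsetP => [|[j _ ->]//].
by case: c => [[[w j]|[]]|[]] //= [->]; exists j.
Qed.

Lemma card_grd v : #|grd v| = b.
Proof.
pose f (j : 'I_b) : cell := inl (inr (v, j)).
rewrite -[RHS]card_ord -(card_imset _ (_ : injective f)); last by move=> ? ? [].
congr #|pred_of_set _|; apply/setP=> c; rewrite inE; apply/eqP/imsetP => [|[j _ ->]//].
by case: c => [[[]|[w j]]|[]] //= [->]; exists j.
Qed.

Lemma card_pool : #|pool| = z.
Proof.
pose f (j : 'I_z) : cell := inr (inl j).
rewrite -[RHS]card_ord -(card_imset _ (_ : injective f)); last by move=> ? ? [].
congr #|pred_of_set _|; apply/setP=> c; rewrite inE; apply/eqP/imsetP => [|[j _ ->]//].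
by case: c => [[[]|[]]|[j|]] //=; exists j.
Qed.

Lemma card_extra : #|extra| = e.
Proof.
pose f (j : 'I_e) : cell := inr (inr j).
rewrite -[RHS]card_ord -(card_imset _ (_ : injective f)); last by move=> ? ? [].
congr #|pred_of_set _|; apply/setP=> c; rewrite inE; apply/eqP/imsetP => [|[j _ ->]//].
by case: c => [[[]|[]]|[|j]] //=; exists j.
Qed.

Lemma card_small_set : #|small_set| = m + e.
Proof.
rewrite cardsU card_blk card_extra (_ : _ :&: _ = set0) ?cards0 ?subn0 //.
by apply/setP=> c; rewrite !inE; case: eqP => // ->.
Qed.

Lemma node0 x y : node x y 0 = root x. Proof. by rewrite /node eqxx. Qed.
Lemma nodeL x y : node x y (L x) = root x. Proof. by rewrite /node eqxx orbT. Qed.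

Lemma node_in x y i : 0 < i < L x -> node x y i = edge x y i.
Proof. by rewrite /node => /andP[]; case: eqP => [->|_]//= _; case: eqP => // ->; rewrite ltnn. Qed.

Lemma edge_inj x y i x' y' i' : i < L x -> i' < L x' ->
  edge x y i = edge x' y' i' -> [/\ x = x', y = y' & i = i'].
Proof.
move=> lti lti' [-> -> /(congr1 (@nat_of_ord _))].
have leP := L_leP x; have leP' := L_leP x'.
by rewrite !inordK; [split|lia|lia].
Qed.

Lemma node_cases x y i : i <= L x -> node x y i = root x \/ 0 < i < L x.
Proof.
case: (posnP i) => [-> _|i_gt0]; first by left; rewrite node0.
by rewrite leq_eqVlt => /orP[/eqP->|]; [left; rewrite nodeL | right; apply/andP].
Qed.

Lemma node_in_root x y i x' : 0 < i < L x -> node x y i <> root x'.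
Proof.
move=> i_in; rewrite node_in // => -[_ _ /(congr1 (@nat_of_ord _))].
by have leP := L_leP x; rewrite inordK /=; lia.
Qed.

Lemma node_in_inj x y i x' y' i' : 0 < i < L x -> i' <= L x' ->
  node x y i = node x' y' i' -> [/\ x = x', y = y' & i = i'].
Proof.
move=> i_in le_i'; have [->|i'_in] := node_cases y' le_i'.
  by move/(node_in_root i_in).
by rewrite !node_in //; apply: edge_inj; lia.
Qed.

Lemma node_neqS x y i : i < L x -> node x y i <> node x y i.+1.
Proof.
move=> lti eqn; have := L_gt1 x => L1.
case: (posnP i) => [i0|i_gt0].
  have i1 : 0 < i.+1 < L x by lia.
  by have [_ _] := node_in_inj i1 (ltnW lti) (esym eqn); lia.
have i1 : 0 < i < L x by lia.
by have [_ _] := node_in_inj i1 lti eqn; lia.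
Qed.

Definition alive (S : {set cell}) x y i j : Prop :=
  (forall k, i <= k <= j -> ~~ meets (blk (node x y k)) S) /\
  (forall k, i <= k < j -> ~~ (grd (edge x y k) \subset S)).

Lemma aliveS (S S' : {set cell}) x y i j :
  S \subset S' -> alive S' x y i j -> alive S x y i j.
Proof.
move=> sSS' [an ag]; split=> k /[dup] kij => [/an|/ag]; apply: contra.
  exact: meetsS.
by move/subset_trans; apply.
Qed.

Lemma alive_sub (S : {set cell}) x y i j i' j' :
  i <= i' -> j' <= j -> alive S x y i j -> alive S x y i' j'.
Proof. by move=> lei lej [an ag]; split=> k kij; [apply: an|apply: ag]; lia. Qed.
(* lia would spend most of its time translating the set-theoretic hypotheses. *)
Ltac arith := repeat match goal with
  | H : forall x : _, _ |- _ => clear H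
  | H : context [meets] |- _ => clear H
  | H : context [alive] |- _ => clear H
  | H : context [legal_move] |- _ => clear H
  | H : context [mem] |- _ => clear H
  | H : context [node] |- _ => clear H
  end; lia.

Lemma meets_setU (T : finType) (A B C : {set T}) :
  meets A (B :|: C) = meets A B || meets A C.
Proof. by rewrite /meets setIUr setU_eq0 negb_and. Qed.

Lemma legal_moveP (k : nat) (M S X : {set cell}) :
  reflect ((forall c, c \in X -> c \notin M /\ c \notin S) /\ #|X| <= k)
    (legal_move k M S X).
Proof.
apply: (iffP andP) => -[sX leX]; split=> //.
  by move=> c cX; move/subsetP: sX => /(_ _ cX); rewrite !inE negb_or => /andP.
by apply/subsetP=> c /sX[cM cS]; rewrite !inE negb_or cM.
Qed.

(** * Staller's strategy *)

Section Staller.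

Variables (theta : 'I_b.+2 -> nat -> nat) (lost : pred 'I_b.+2).
Hypothesis theta_anti : forall x j, theta x j.+1 <= theta x j.
Hypothesis theta_root : forall x j, ~~ lost x -> theta x j.+1 < L x.
Hypothesis theta_split : forall x j l1 l2,
  theta x j < l1 + l2 -> l1 + l2 <= L x -> 0 < l1 -> 0 < l2 ->
  l1 <= theta x j.+1 -> l2 <= theta x j.+1 -> [&& 1 < b, 1 < l1 & 1 < l2].

Local Notation own M v := (blk v \subset M).
Local Notation dead S v := (meets (blk v) S).

(* Staller's invariant after j1 moves of Dominator that claim a whole block and
   j2 others. Components satisfying [lost] have a root hit by Staller; [theta]
   bounds below the length of the uncut segments with claimed ends. *)
Record inv (j1 j2 : nat) (M S : {set cell}) : Prop := Inv {
  inv_disj : ~~ meets M S;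
  inv_blk : forall v, [|| own M v, ~~ meets (blk v) M | dead S v];
  inv_grd : forall x y i, i < L x -> meets (grd (edge x y i)) M ->
    [|| dead S (node x y i), dead S (node x y i.+1)
      | own M (node x y i) && own M (node x y i.+1)];
  inv_seg : forall x y i j, i < j <= L x ->
    own M (node x y i) -> own M (node x y j) -> alive S x y i j ->
    theta x j1 < j - i;
  inv_root : forall x y i, 0 < i < L x -> own M (node x y i) ->
    own M (root x) || dead S (root x);
  inv_lost : forall x, lost x -> dead S (root x);
  inv_small : meets small_set S || ~~ meets small_set M;
  inv_loose : #|M :&: loose| <= m * j2 }.

Lemma blk_cell v : exists c, c \in blk v.
Proof. by apply/set0Pn; rewrite -card_gt0 card_blk. Qed.

Lemma blk_eq v v' c : c \in blk v -> c \in blk v' -> v = v'.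
Proof. by rewrite !inE => /eqP-> /eqP[]. Qed.

Lemma own_dead M S v : ~~ meets M S -> own M v -> dead S v -> False.
Proof.
move=> dMS /subsetP sM /meetsP[c /sM cM cS].
by case/negP: dMS; apply/meetsP; exists c.
Qed.

Lemma own_alive (S : {set cell}) x y i j : i <= j -> alive S x y i j ->
  ~~ dead S (node x y i) /\ ~~ dead S (node x y j).
Proof. by move=> le_ij [an _]; split; apply: an; rewrite leqnn le_ij. Qed.

Lemma inv0 S : (forall x, lost x -> dead S (root x)) -> inv 0 0 set0 S.
Proof.
have none (A : {set cell}) : meets A set0 = false by rewrite /meets setI0 eqxx.
have no v : own set0 v = false.
  by have [c cv] := blk_cell v; apply/negP=> /subsetP/(_ _ cv); rewrite inE.
move=> lostP; split=> //; try by move=> *; rewrite ?none ?no ?orbT.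
- by rewrite /meets set0I eqxx.
- by move=> x y i _; rewrite none.
- by move=> x y i j _; rewrite no.
- by move=> x y i _; rewrite no.
- by rewrite set0I cards0.
Qed.

Lemma step_scatter j1 j2 M S X :
  inv j1 j2 M S -> legal_move m M S X -> (forall v, X != blk v) ->
  exists2 Y, legal_move b (M :|: X) S Y & inv j1 j2.+1 (M :|: X) (S :|: Y).
Proof.
move=> I /legal_moveP[dX leX] Xblk; set M' := M :|: X.
have dM'S : ~~ meets M' S.
  apply/negP=> /meetsP[c]; rewrite inE => /orP[cM|/dX[_ /negP//]] cS.
  by case/negP: (inv_disj I); apply/meetsP; exists c.
have own_old v : ~~ dead S v -> own M' v -> own M v.
  move=> ndS oM'; case/or3P: (inv_blk I v) => // [untouched|]; last by rewrite (negPf ndS).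
  case/negP: (Xblk v); rewrite eq_sym eqEcard card_blk leX andbT.
  apply/subsetP=> c cv; move/subsetP/(_ c cv): oM'; rewrite inE => /orP[cM|//].
  by case/negP: untouched; apply/meetsP; exists c.
(* Each cell c of X is answered by a cell of tgt c: a block or the small winning
   set that was touched is hit, a touched guard is made useless by hitting a
   neighbouring block. *)
pose tgt c : {set cell} := match label c with
  | inl (inl v) => blk v :\: M'
  | inl (inr (x, y, i)) =>
      if own M' (node x y i) then blk (node x y i.+1) :\: M'
      else blk (node x y i) :\: M'
  | inr false => small_set :\: M'
  | inr true => set0
  end.
pose resp c := odflt c [pick w in tgt c].
pose Y := (resp @: X) :\: (M' :|: S).
have key c w0 : c \in X -> w0 \in tgt c -> exists2 w, w \in tgt c & w \in S :|: Y.
  move=> cX w0t; exists (resp c).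
    by rewrite /resp; case: pickP => //= /(_ w0); rewrite w0t.
  have wt : resp c \in tgt c.
    by rewrite /resp; case: pickP => //= /(_ w0); rewrite w0t.
  have wM' : resp c \notin M'.
    by move: wt; rewrite /tgt; case: (label c) => [[v|[[x y] i]]|[]];
      [|case: ifP => _| |]; rewrite !inE // => /andP[].
  rewrite inE; case: (boolP (resp c \in S)) => //= wS; rewrite inE imset_f // andbT.
  by rewrite inE negb_or wM'.
have legalY : legal_move b M' S Y.
  apply/legal_moveP; split=> [c|].
    by rewrite inE inE negb_or => /andP[/andP[]].
  apply: leq_trans (subset_leq_card (subsetDl _ _)) _.
  by apply: leq_trans (leq_imset_card _ _) (leq_trans leX le_mb).
have sMM' : M \subset M' by apply: subsetUl.
have sSS' : S \subset S :|: Y by apply: subsetUl.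
have outside v : ~~ own M' v -> exists c, c \in blk v :\: M'.
  by case/subsetPn=> c cv cM'; exists c; rewrite inE cM'.
have kill_blk v c : c \in X -> c \in blk v -> own M' v || dead (S :|: Y) v.
  move=> cX; rewrite inE => /eqP cv; case: (boolP (own M' v)) => //= /outside[w0 w0v].
  have [|w] := key c w0 cX; first by rewrite /tgt cv.
  by rewrite {1}/tgt cv inE => /andP[_ wv] wS; apply/meetsP; exists w.
exists Y => //; split.
- rewrite meets_setU (negPf dM'S) /=; apply/negP=> /meetsP[c cM'].
  by case/setDP=> _; rewrite inE cM'.
- move=> v; case/or3P: (inv_blk I v) => [oM|untouched|dS].
  + by rewrite (subset_trans oM).
  + case: (boolP (meets (blk v) X)) => [/meetsP[c cv cX]|nX].
      by case/orP: (kill_blk v c cX cv) => ->; rewrite ?orbT.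
    by rewrite [meets _ M']meets_setU (negPf untouched) (negPf nX) orbT.
  + by rewrite (meetsS sSS' dS) !orbT.
- move=> x y i lti /meetsP[c cg]; rewrite inE => /orP[cM|cX].
    have touched : meets (grd (edge x y i)) M by apply/meetsP; exists c.
    case/or3P: (inv_grd I lti touched).
    + by move/(meetsS sSS') ->.
    + by move/(meetsS sSS') ->; rewrite orbT.
    + by case/andP=> /subset_trans/(_ sMM')-> /subset_trans/(_ sMM')->; rewrite !orbT.
  have tgtE : tgt c = if own M' (node x y i) then blk (node x y i.+1) :\: M'
      else blk (node x y i) :\: M'.
    move: cg; rewrite inE /tgt => /eqP->.
    have := L_leP x => le_LP; rewrite /edge /= inordK //; lia.
  case: (boolP (own M' (node x y i))) => [o1|no1]; rewrite ?o1 ?(negPf no1) in tgtE.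
    case: (boolP (own M' (node x y i.+1))) => [o2|/outside[w0 w0t]]; first by rewrite !orbT.
    have [|w] := key c w0 cX; first by rewrite tgtE.
    rewrite {1}tgtE inE => /andP[_ wv] wS.
    by apply/or3P/Or32/meetsP; exists w.
  have [w0 w0t] := outside _ no1; have [|w] := key c w0 cX; first by rewrite tgtE.
  rewrite {1}tgtE inE => /andP[_ wv] wS.
  by apply/or3P/Or31/meetsP; exists w.
- move=> x y i j lt_ij o1 o2 /(aliveS sSS') al.
  have le_ij : i <= j by case/andP: lt_ij => /ltnW.
  have [nd1 nd2] := own_alive le_ij al.
  by apply: (inv_seg I) al => //; apply: own_old.
- move=> x y i i_in o1; have nd : ~~ dead S (node x y i).
    by apply/negP; apply: own_dead o1.
  case/orP: (inv_root I i_in (own_old _ nd o1)) => [/subset_trans/(_ sMM')->//|].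
  by move/(meetsS sSS') ->; rewrite orbT.
- by move=> x /(inv_lost I); apply: meetsS.
- case/orP: (inv_small I) => [/(meetsS sSS') ->//|untouched].
  case: (boolP (meets small_set S)) => [/(meetsS sSS') ->//|nS].
  case: (boolP (meets small_set X)) => [|nX]; last first.
    by rewrite [meets _ M']meets_setU (negPf untouched) (negPf nX) orbT.
  case/meetsP=> c csm cX; apply/orP; left; move: (csm); rewrite inE => /orP[cr|ce].
    have nd : ~~ dead S (root ord0) by apply: contra nS; apply/meetsSl/subsetUl.
    case/orP: (kill_blk _ _ cX cr) => [/(own_old _ nd)/subsetP/(_ _ cr) cM|].
      by case/negP: untouched; apply/meetsP; exists c.
    exact/meetsSl/subsetUl.
  have tgtE : tgt c = small_set :\: M' by move: ce; rewrite inE /tgt => /eqP->.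
  have [w0 w0t] : exists w0, w0 \in small_set :\: M'.
    apply/set0Pn; rewrite setD_eq0; apply/negP=> sm.
    suff : small_set \subset X by move/subset_leq_card/leq_trans/(_ leX);
      rewrite card_small_set -[leqRHS]addn0 leq_add2l leqNgt e_gt0.
    apply/subsetP=> w ws; move/subsetP/(_ w ws): sm; rewrite inE => /orP[wM|//].
    by case/negP: untouched; apply/meetsP; exists w.
  have [|w] := key c w0 cX; first by rewrite tgtE.
  by rewrite {1}tgtE inE => /andP[_ wv] wS; apply/meetsP; exists w.
- rewrite setIUl mulnS addnC; have [+ _] := leq_card_setU (M :&: loose) (X :&: loose).
  have := subset_leq_card (subsetIl X loose); have := inv_loose I; lia.
Qed.

Lemma own_claim M v u : u <> v -> own (M :|: blk v) u -> own M u.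
Proof.
move=> neq_uv /subsetP sub; apply/subsetP=> c cu.
by move: (sub c cu); rewrite inE => /orP[//|/(blk_eq cu)/neq_uv].
Qed.

Lemma meets_claim M v u : u <> v -> meets (blk u) (M :|: blk v) = meets (blk u) M.
Proof.
move=> neq_uv; rewrite meets_setU orb_idr // => /meetsP[c cu cv].
by case: neq_uv; apply: blk_eq cu cv.
Qed.

Lemma claim_fresh k M S v : legal_move k M S (blk v) ->
  ~~ meets (blk v) M /\ ~~ dead S v.
Proof.
by move=> /legal_moveP[dv _]; split; apply/negP=> /meetsP[c /dv[cM cS]]; apply/negP.
Qed.

Lemma not_own_fresh M v : ~~ meets (blk v) M -> ~~ own M v.
Proof.
move=> fresh; have [c cv] := blk_cell v; apply: contra fresh => /subsetP/(_ c cv) cM.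
by apply/meetsP; exists c.
Qed.

Lemma step_claim j1 j2 M S v Y :
  inv j1 j2 M S -> legal_move m M S (blk v) -> legal_move b (M :|: blk v) S Y ->
  (forall x y i j, i < j <= L x -> node x y i = v \/ node x y j = v ->
     own (M :|: blk v) (node x y i) -> own (M :|: blk v) (node x y j) ->
     alive (S :|: Y) x y i j -> theta x j1.+1 < j - i) ->
  (forall x y i, 0 < i < L x -> node x y i = v ->
     own M (root x) || dead (S :|: Y) (root x)) ->
  (v = root ord0 -> meets small_set (S :|: Y)) ->
  inv j1.+1 j2 (M :|: blk v) (S :|: Y).
Proof.
move=> I lv /legal_moveP[dY _] segv rootv smallv; have [fvM fvS] := claim_fresh lv.
have sMM' : M \subset M :|: blk v by apply: subsetUl.
have sSS' : S \subset S :|: Y by apply: subsetUl.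
split.
- rewrite meets_setU; apply/norP; split; last first.
    by apply/negP=> /meetsP[c cM' /dY[/negP]].
  apply/negP=> /meetsP[c]; rewrite inE => /orP[cM|cv] cS.
    by case/negP: (inv_disj I); apply/meetsP; exists c.
  by case/negP: fvS; apply/meetsP; exists c.
- move=> u; have [->|/eqP neq] := eqVneq u v; first by rewrite subsetUr.
  rewrite meets_claim //; case/or3P: (inv_blk I u) => [oM|->|dS].
  + by rewrite (subset_trans oM).
  + by rewrite orbT.
  + by rewrite (meetsS sSS' dS) !orbT.
- move=> x y i lti; rewrite [meets (grd _) _]meets_setU => /orP[gM|/meetsP[c]]; last first.
    by rewrite !inE => /eqP->.
  case/or3P: (inv_grd I lti gM) => [/(meetsS sSS')->//|/(meetsS sSS')->|].
    by rewrite orbT.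
  by case/andP=> /subset_trans/(_ sMM')-> /subset_trans/(_ sMM')->; rewrite !orbT.
- move=> x y i j lt_ij oi oj al.
  have [eqi|/eqP neqi] := eqVneq (node x y i) v; first by apply: segv al => //; left.
  have [eqj|/eqP neqj] := eqVneq (node x y j) v; first by apply: segv al => //; right.
  apply: leq_ltn_trans (theta_anti x j1) _.
  exact: (inv_seg I lt_ij (own_claim neqi oi) (own_claim neqj oj) (aliveS sSS' al)).
- move=> x y i i_in oi; have [eqi|/eqP neqi] := eqVneq (node x y i) v.
    case/orP: (rootv x y i i_in eqi) => [/subset_trans/(_ sMM')->//|->].
    by rewrite orbT.
  case/orP: (inv_root I i_in (own_claim neqi oi)) => [/subset_trans/(_ sMM')->//|].
  by move/(meetsS sSS') ->; rewrite orbT.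
- by move=> x /(inv_lost I); apply: meetsS.
- have [/smallv->//|/eqP neq] := eqVneq v (root ord0).
  case/orP: (inv_small I) => [/(meetsS sSS')->//|untouched]; apply/orP; right.
  rewrite meets_setU (negPf untouched) /=; apply/negP=> /meetsP[c cs cv].
  move: cs cv; rewrite !inE => /orP[] /eqP-> // /eqP[] /esym; exact: neq.
- rewrite setIUl (_ : blk v :&: loose = set0) ?setU0; first exact: inv_loose I.
  by apply/setP=> c; rewrite !inE; case: eqP => // ->.
Qed.

Lemma cut (M S : {set cell}) v u w : u <> v ->
  [|| own M u, ~~ meets (blk u) M | dead S u] -> ~~ dead S u ->
  (own M u -> ~~ meets (grd w) M) ->
  exists Y : {set cell}, [/\ Y \subset ~: ((M :|: blk v) :|: S),
    #|Y| <= (if own M u then b else 1) &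
    if own M u then grd w \subset S :|: Y else dead (S :|: Y) u].
Proof.
move=> neq_uv status nd; case: ifP => [oM|noM] fresh.
  exists (grd w :\: S); split.
  - apply/subsetP=> c; rewrite inE => /andP[cS cg]; rewrite !inE (negPf cS) orbF.
    rewrite negb_or; apply/andP; split.
      by apply: contra (fresh isT) => cM; apply/meetsP; exists c.
    by move: cg; rewrite inE => /eqP->.
  - by rewrite -(card_grd w) subset_leq_card // subsetDl.
  - by apply/subsetP=> c cg; rewrite !inE; case: (c \in S) => //=; rewrite inE in cg.
have [c cu] := blk_cell u; exists [set c]; rewrite cards1; split=> //; last first.
  by apply/meetsP; exists c; rewrite // !inE eqxx orbT.
rewrite sub1set !inE !negb_or; apply/andP; split; last first.
  by apply: contra nd => cS; apply/meetsP; exists c.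
apply/andP; split.
  move: status; rewrite noM (negPf nd) orbF /=.
  by apply: contra => cM; apply/meetsP; exists c.
by move: cu; rewrite inE => /eqP->; apply/eqP=> -[].
Qed.

Lemma cut_left j1 j2 M S x y p t : inv j1 j2 M S -> 0 < p < L x ->
  legal_move m M S (blk (node x y p)) ->
  exists Y : {set cell}, [/\ Y \subset ~: ((M :|: blk (node x y p)) :|: S),
    Y = set0 \/ (exists l, [/\ 0 < l <= p, l <= t, own M (node x y (p - l)),
                  alive S x y (p - l) p & #|Y| <= (if l == 1 then b else 1)]) &
    forall i, i < p -> own M (node x y i) -> alive (S :|: Y) x y i p -> t < p - i].
Proof.
move=> I /andP[p_gt0 ltp] lv; have [fvM fvS] := claim_fresh lv.
pose short i := [/\ i < p, own M (node x y i), alive S x y i p & p - i <= t].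
case: (pselect (exists i, short i)) => [[i [ltip oi al let_]]|none]; last first.
  exists set0; split; [exact: sub0set|by left|rewrite setU0 => i ltip oi al].
  by rewrite ltnNge; apply/negP=> le; apply: none; exists i.
have lt1p : p.-1 < L x by arith.
have eqp : p.-1.+1 = p by arith.
have al1 : alive S x y p.-1 p by apply: alive_sub al; arith.
have [nd1 _] := own_alive (leq_pred p) al1.
have neq : node x y p.-1 <> node x y p by rewrite -{2}eqp; apply: node_neqS.
have [|Y [sY cY kY]] := cut (w := edge x y p.-1) neq (inv_blk I _) nd1.
  move=> o1; apply/negP=> /(inv_grd I lt1p); rewrite eqp (negPf nd1) (negPf fvS) /=.
  by rewrite (negPf (not_own_fresh fvM)) andbF.
exists Y; split=> //.
  right; case: ifP cY {kY} => [o1|no1] cY.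
    by exists 1; rewrite subn1; split=> //; arith.
  exists (p - i); rewrite subKn ?(ltnW ltip) //; split=> //; first by arith.
  case: eqP => // eq1; have eqi : i = p.-1 by arith.
  by rewrite eqi no1 in oi.
move=> i' ltip' _ [an ag]; case: ifP kY => [_ gone|_ dd].
  by have := ag p.-1; rewrite gone => /(_ _)/notF[]; arith.
by have := an p.-1; rewrite dd => /(_ _)/notF[]; arith.
Qed.

Lemma cut_right j1 j2 M S x y p t : inv j1 j2 M S -> 0 < p < L x ->
  legal_move m M S (blk (node x y p)) ->
  exists Y : {set cell}, [/\ Y \subset ~: ((M :|: blk (node x y p)) :|: S),
    Y = set0 \/ (exists l, [/\ 0 < l, p + l <= L x & l <= t] /\
                  [/\ own M (node x y (p + l)),
                  alive S x y p (p + l) & #|Y| <= (if l == 1 then b else 1)]) &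
    forall j, p < j <= L x -> own M (node x y j) ->
      alive (S :|: Y) x y p j -> t < j - p].
Proof.
move=> I /andP[p_gt0 ltp] lv; have [fvM fvS] := claim_fresh lv.
pose short j := [/\ p < j <= L x, own M (node x y j), alive S x y p j & j - p <= t].
case: (pselect (exists j, short j)) => [[j [ltpj oj al let_]]|none]; last first.
  exists set0; split; [exact: sub0set|by left|rewrite setU0 => j ltpj oj al].
  by rewrite ltnNge; apply/negP=> le; apply: none; exists j.
have al1 : alive S x y p p.+1 by apply: alive_sub al; arith.
have [_ nd1] := own_alive (leqnSn p) al1.
have neq : node x y p.+1 <> node x y p by apply/nesym/node_neqS.
have [|Y [sY cY kY]] := cut (w := edge x y p) neq (inv_blk I _) nd1.
  move=> o1; apply/negP=> /(inv_grd I ltp); rewrite (negPf nd1) (negPf fvS) /=.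
  by rewrite (negPf (not_own_fresh fvM)).
exists Y; split=> //.
  right; case: ifP cY {kY} => [o1|no1] cY.
    by exists 1; rewrite addn1; split; split=> //; arith.
  exists (j - p); rewrite subnKC; last by arith.
  split; first by split=> //; arith.
  split=> //; case: eqP => // eq1; have eqj : j = p.+1 by arith.
  by rewrite eqj no1 in oj.
move=> j' ltpj' _ [an ag]; case: ifP kY => [_ gone|_ dd].
  by have := ag p; rewrite gone => /(_ _)/notF[]; arith.
by have := an p.+1; rewrite dd => /(_ _)/notF[]; arith.
Qed.

Lemma alive_cat (S : {set cell}) x y i p j :
  alive S x y i p -> alive S x y p j -> alive S x y i j.
Proof.
move=> [an1 ag1] [an2 ag2]; split=> k kij.
  by case: (leqP k p) => kp; [apply: an1|apply: an2]; arith.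
by case: (ltnP k p) => kp; [apply: ag1|apply: ag2]; arith.
Qed.

Lemma step_root j1 j2 M S x :
  inv j1 j2 M S -> legal_move m M S (blk (root x)) ->
  exists2 Y, legal_move b (M :|: blk (root x)) S Y &
    inv j1.+1 j2 (M :|: blk (root x)) (S :|: Y).
Proof.
move=> I lv; have [fvM fvS] := claim_fresh lv.
have nov := not_own_fresh fvM.
suff [Y lY smallY] : exists2 Y, legal_move b (M :|: blk (root x)) S Y &
    (root x = root ord0 -> meets small_set (S :|: Y)).
  exists Y => //; apply: step_claim => //; last first.
    by move=> x' y i /node_in_root eqv /eqv.
  move=> x' y i j /andP[lt_ij lejL] eqv oi oj _.
  have noin k : k <= L x' -> x' = x -> own (M :|: blk (root x)) (node x' y k) ->
      node x' y k = root x'.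
    move=> lek eqx ok; have [//|k_in] := node_cases y lek.
    have := inv_root I k_in (own_claim (node_in_root k_in) ok).
    by rewrite eqx (negPf nov) (negPf fvS).
  have eqx : x' = x.
    have eqr k : k <= L x' -> node x' y k = root x -> x' = x.
      move=> lek; have [->|k_in] := node_cases y lek; first by case.
      by move/(node_in_root k_in).
    by case: eqv => /eqr; apply; arith.
  have i0 : i = 0.
    have := noin i _ eqx oi; case: (posnP i) => // i_gt0 /(_ _) h.
    by case: (@node_in_root x' y i x'); [arith|apply: h; arith].
  have jL : j = L x'.
    have := noin j _ eqx oj; move: lejL; rewrite leq_eqVlt => /orP[/eqP//|ltj] h.
    by case: (@node_in_root x' y j x'); [arith|apply: h; arith].
  rewrite i0 jL subn0; apply: theta_root; apply: contra fvS => /(inv_lost I).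
  by rewrite eqx.
case: (boolP (meets small_set S)) => [dS|ndS].
  exists set0; last by rewrite setU0.
  by rewrite /legal_move sub0set cards0.
have [c ce] : exists c, c \in extra by apply/set0Pn; rewrite -card_gt0 card_extra.
have cs : c \in small_set by rewrite inE ce orbT.
exists [set c]; last by move=> _; apply/meetsP; exists c; rewrite // !inE eqxx orbT.
apply/legal_moveP; rewrite cards1; split=> [c'|]; last exact: leq_trans le_mb.
rewrite inE => /eqP->; split; last by apply: contra ndS => cS; apply/meetsP; exists c.
rewrite inE negb_or; apply/andP; split.
  have := inv_small I; rewrite (negPf ndS) /=.
  by apply: contra => cM; apply/meetsP; exists c.
by move: ce; rewrite !inE => /eqP->.
Qed.

Lemma step_inner j1 j2 M S x y p : 0 < p < L x ->
  inv j1 j2 M S -> legal_move m M S (blk (node x y p)) ->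
  exists2 Y, legal_move b (M :|: blk (node x y p)) S Y &
    inv j1.+1 j2 (M :|: blk (node x y p)) (S :|: Y).
Proof.
move=> p_in I lv; have [fvM fvS] := claim_fresh lv; set v := node x y p in lv fvM fvS *.
have nroot : v = root ord0 -> False by apply: node_in_root.
have same x' y' k : k <= L x' -> node x' y' k = v -> [/\ x = x', y = y' & p = k].
  by move=> lek eqv; apply: node_in_inj p_in lek (esym eqv).
case: (boolP (own M (root x) || dead S (root x))) => [rootP|]; last first.
  rewrite negb_or => /andP[noR ndR].
  have [c cr] := blk_cell (root x).
  have lc : legal_move b (M :|: blk v) S [set c].
    apply/legal_moveP; rewrite cards1; split=> [c'|]; last exact: leq_trans le_mb.
    rewrite inE => /eqP->; split; last first.
      by apply: contra ndR => cS; apply/meetsP; exists c.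
    rewrite inE negb_or; apply/andP; split.
      have := inv_blk I (root x); rewrite (negPf noR) (negPf ndR) orbF /=.
      by apply: contra => cM; apply/meetsP; exists c.
    by apply/negP=> /(blk_eq cr)/esym; apply: node_in_root.
  have deadR : dead (S :|: [set c]) (root x).
    by apply/meetsP; exists c; rewrite // !inE eqxx orbT.
  exists [set c]; first exact: lc.
  apply: (step_claim I lv lc); last 2 first.
  - by move=> x' y' i i_in /same[|<- _ _]; [arith|rewrite deadR orbT].
  - by move/nroot.
    move=> x' y' i j /andP[lt_ij lejL] eqv oi oj _; exfalso.
  have noown k : k <= L x -> p <> k -> own (M :|: blk v) (node x y k) -> False.
    move=> lek neq ok; have ok' : own M (node x y k).
      by apply: own_claim ok => /(same _ _ _ lek)[].
    have [eqr|k_in] := node_cases y lek; first by rewrite eqr (negPf noR) in ok'.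
    by have := inv_root I k_in ok'; rewrite (negPf noR) (negPf ndR).
  case: eqv => /same[|eqx eqy eqp]; try arith; subst x' y'.
    by apply: (noown j) oj => //; arith.
  by apply: (noown i) oi => //; arith.
have [Yl [sYl cYl kYl]] := cut_left (theta x j1.+1) I p_in lv.
have [Yr [sYr cYr kYr]] := cut_right (theta x j1.+1) I p_in lv.
have lY : legal_move b (M :|: blk v) S (Yl :|: Yr).
  rewrite /legal_move subUset sYl sYr /=.
  have le1 l : (if l == 1 then b else 1) <= b by case: ifP => // _; apply: leq_trans le_mb.
  case: cYl => [->|[l [l_in let_ ol all cl]]].
    rewrite set0U; case: cYr => [->|[l [_ [_ _ cl]]]]; first by rewrite cards0.
    exact: leq_trans cl (le1 l).
  case: cYr => [->|[l' [[l'_gt0 l'_le le't] [ol' all' cl']]]].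
    rewrite setU0; exact: leq_trans cl (le1 l).
  have /and3P[b1 l1 l'1] : [&& 1 < b, 1 < l & 1 < l'].
    have lt_seg : p - l < p + l' <= L x by arith.
    have := inv_seg I lt_seg ol ol' (alive_cat all all').
    have -> : p + l' - (p - l) = l + l' by arith.
    by move/theta_split; apply => //; arith.
  rewrite gtn_eqF // in cl; rewrite gtn_eqF // in cl'.
  exact: leq_trans (leq_trans (leq_card_setU Yl Yr) (leq_add cl cl')) b1.
exists (Yl :|: Yr); first exact: lY.
apply: (step_claim I lv lY); last 1 first.
- by move/nroot.
  move=> x' y' i j /andP[lt_ij lejL] eqv oi oj al.
  have old k : k <= L x -> p <> k -> own (M :|: blk v) (node x y k) -> own M (node x y k).
    by move=> lek neq; apply: own_claim => /(same _ _ _ lek)[].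
  case: eqv => /same[|eqx eqy eqp]; try arith; subst x' y'.
    subst i; apply: kYr; [arith|by apply: old oj => //; arith|].
    by apply: aliveS al; rewrite setUS // subsetUr.
  subst j; apply: kYl; [arith|by apply: old oi => //; arith|].
  by apply: aliveS al; rewrite setUS // subsetUl.
move=> x' y' i i_in /same[|<- _ _]; first by arith.
case/orP: rootP => [->//|/(meetsS (subsetUl S (Yl :|: Yr)))->]; by rewrite orbT.
Qed.

Lemma step j1 j2 M S X : inv j1 j2 M S -> legal_move m M S X ->
  exists2 Y, legal_move b (M :|: X) S Y &
    inv j1.+1 j2 (M :|: X) (S :|: Y) \/ inv j1 j2.+1 (M :|: X) (S :|: Y).
Proof.
move=> I lX; case: (pselect (exists v, X = blk v)) => [[v eqX]|noblk]; last first.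
  have [|Y lY IY] := step_scatter I lX; last by exists Y => //; right.
  by move=> v; apply/eqP=> eqX; apply: noblk; exists v.
subst X; suff [Y lY IY] : exists2 Y, legal_move b (M :|: blk v) S Y &
    inv j1.+1 j2 (M :|: blk v) (S :|: Y) by exists Y => //; left.
case: (pselect (exists x, v = root x)) => [[x eqv]|noroot].
  by subst v; apply: step_root.
case: (pselect (exists x y p, 0 < p < L x /\ v = node x y p)) => [[x [y [p [p_in eqv]]]]|noinner].
  by subst v; apply: step_inner.
have junk x y i : i <= L x -> node x y i <> v.
  move=> lei eqv; have [eqr|i_in] := node_cases y lei.
    by apply: noroot; exists x; rewrite -eqr.
  by apply: noinner; exists x, y, i.
have l0 : legal_move b (M :|: blk v) S set0 by rewrite /legal_move sub0set cards0.
exists set0 => //; apply: step_claim => //.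
- move=> x y i j /andP[lt_ij lejL] [] /junk[] //; arith.
- by move=> x y i i_in /junk[]; arith.
- by move=> eqv; case: noroot; exists ord0.
Qed.

Lemma staller_survives (goal : {set cell} -> Prop) N S :
  (forall j1 j2 M S', inv j1 j2 M S' -> j1 + j2 <= N -> ~ goal M) ->
  (forall x, lost x -> dead S (root x)) ->
  forall n, n <= N -> ~ dom_forces goal m b n set0 S.
Proof.
move=> safe lostP n le_nN.
pose I j M S' := exists j1 j2, j1 + j2 = j /\ inv j1 j2 M S'.
apply: (@not_dom_forces _ goal m b I N) (_ : I 0 set0 S) (_ : 0 + n <= N) => //.
- by move=> j M S' [j1 [j2 [<- Inv]]]; apply: safe Inv.
- move=> j M S' X [j1 [j2 [<- Inv]]] lX; have [Y lY [IY|IY]] := step Inv lX; exists Y => //.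
    by exists j1.+1, j2.
  by exists j1, j2.+1; rewrite addnS.
- by exists 0, 0; split=> //; apply: inv0.
Qed.

Lemma inv_not_small j1 j2 M S : inv j1 j2 M S -> ~~ (small_set \subset M).
Proof.
move=> I; apply/negP=> /subsetP sub; case/orP: (inv_small I) => [/meetsP[c cs cS]|].
  by case/negP: (inv_disj I); apply/meetsP; exists c; rewrite ?sub.
have [c cr] := blk_cell (root ord0); have cs : c \in small_set by rewrite inE cr.
by case/negP; apply/meetsP; exists c; rewrite ?sub.
Qed.

Lemma inv_linked j1 j2 M S x y i : inv j1 j2 M S -> linked M x y i ->
  theta x j1 = 0.
Proof.
move=> I /and4P[lti o1 o2 /meetsP[c cg cM]].
have nd v : own M v -> ~~ dead S v by move=> o; apply/negP; apply: own_dead (inv_disj I) o.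
have lt : i < i.+1 <= L x by rewrite ltnSn.
suff al : alive S x y i i.+1.
  by have := inv_seg I lt o1 o2 al; rewrite subSnn ltnS leqn0 => /eqP.
split=> j j_in.
  have [->|->] : j = i \/ j = i.+1 by arith.
    exact: nd.
  exact: nd.
have -> : j = i by arith.
apply/negP=> /subsetP/(_ c cg) cS.
by case/negP: (inv_disj I); apply/meetsP; exists c.
Qed.

Lemma inv_loose_ge j1 j2 M S x y i k : inv j1 j2 M S -> linked M x y i ->
  k <= #|M :&: pool| -> k < m * j2.
Proof.
move=> I /and4P[_ _ _ /meetsP[c cg cM]] lek.
suff : k < #|M :&: loose| by have := inv_loose I; arith.
apply: leq_ltn_trans lek _; apply: proper_card; apply/properP; split.
  by apply/setIS/subsetP=> d; rewrite !inE => /eqP->.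
move: cg; rewrite inE => /eqP cE.
by exists c; rewrite !inE ?cM ?cE.
Qed.

End Staller.

(** * Dominator's strategy *)

Lemma exists_subset_card (T : finType) (A : {set T}) k :
  k <= #|A| -> exists2 B : {set T}, B \subset A & #|B| = k.
Proof.
move=> lekA; exists [set c in take k (enum A)].
  by apply/subsetP=> c; rewrite inE => /mem_take; rewrite mem_enum.
by rewrite cardsE (card_uniqP _) ?take_uniq ?enum_uniq // size_takel // -cardE.
Qed.

Lemma missed_value (T U : finType) (f : T -> option U) (h : 'I_b.+1 -> U)
    (Y : {set T}) :
  injective h -> #|Y| <= b -> exists u, forall c, c \in Y -> f c <> Some (h u).
Proof.
move=> inj_h leY; have inj : injective (fun u => Some (h u)) by move=> u u' [/inj_h].
have : ~~ ([set Some (h u) | u in [set: 'I_b.+1]] \subset f @: Y).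
  apply/negP=> /subset_leq_card; rewrite (card_imset _ inj) cardsT card_ord leqNgt.
  by rewrite ltnS (leq_trans (leq_imset_card _ _) leY).
case/subsetPn=> _ /imsetP[u _ ->] miss; exists u => c cY eqf.
by case/negP: miss; rewrite -eqf imset_f.
Qed.

Definition set_size x : nat := 2 * m + 1 + zeta x.

Lemma linked_card (W : {set cell}) x y i : linked W x y i ->
  zeta x <= #|W :&: pool| -> set_size x <= #|W|.
Proof.
move=> /and4P[lti o1 o2 /meetsP[g gg gW]] le_zeta.
pose A := blk (node x y i) :|: blk (node x y i.+1).
have card_A : #|A| = 2 * m.
  rewrite cardsU !card_blk (_ : _ :&: _ = set0) ?cards0 ?subn0 ?mul2n ?addnn //.
  apply/setP=> c; rewrite !inE; apply/andP=> -[/eqP-> /eqP[]].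
  exact: node_neqS.
have card_gA : #|g |: A| = 2 * m + 1.
  by move: gg; rewrite cardsU1 card_A !inE => /eqP->; rewrite addnC.
apply: leq_trans (_ : #|(g |: A) :|: (W :&: pool)| <= _); last first.
  by apply: subset_leq_card; rewrite !subUset sub1set gW o1 o2 subsetIl.
rewrite cardsU card_gA (_ : (g |: A) :&: _ = set0) ?cards0 ?subn0.
  by rewrite /set_size leq_add2l.
apply/setP=> c; rewrite !inE; apply/and3P=> -[/or3P[/eqP->|/eqP->|/eqP->]] //.
by move: gg; rewrite !inE => /eqP->.
Qed.

Lemma linked_small (M : {set cell}) x y i : linked M x y i ->
  zeta x <= #|M :&: pool| -> claims_small win (set_size x) M.
Proof.
move=> /and4P[lti o1 o2 /meetsP[g gg gM]] /exists_subset_card[Q sQ cardQ].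
exists ((g |: (blk (node x y i) :|: blk (node x y i.+1))) :|: Q); split.
- apply/winP; right; exists x, y, i; split.
    apply/and4P; split=> //; last by apply/meetsP; exists g; rewrite // !inE eqxx.
      by apply/subsetP=> c cb; rewrite in_setU in_setU1 in_setU cb /= !orbT.
    by apply/subsetP=> c cb; rewrite in_setU in_setU1 in_setU cb !orbT.
  rewrite -cardQ; apply/subset_leq_card/subsetP=> c cQ; rewrite inE in_setU cQ orbT /=.
  by move/subsetP: sQ => /(_ c cQ); rewrite inE => /andP[].
- by rewrite !subUset sub1set gM o1 o2 (subset_trans sQ) ?subsetIl.
- apply: leq_trans (leq_card_setU _ _) _; rewrite cardQ leq_add2r cardsU1.
  have [+ _] := leq_card_setU (blk (node x y i)) (blk (node x y i.+1)).
  by rewrite !card_blk; case: (_ \notin _); lia.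
Qed.

(* The length of the longest segment with claimed ends in which Dominator, to
   move, can complete two neighbouring blocks by k further blocks. *)
Definition reach (k : nat) : nat := if b == 1 then 2 ^ k else k.+1.

Definition room (M S : {set cell}) (n : nat) : Prop :=
  #|pool :&: (M :|: S)| + (m + b) * n <= z.

Lemma room_step (M S X Y : {set cell}) n : room M S n.+1 -> #|X| <= m -> #|Y| <= b ->
  room (M :|: X) (S :|: Y) n.
Proof.
rewrite /room mulnS => le_z leX leY.
have : #|pool :&: (M :|: X :|: (S :|: Y))| <= #|pool :&: (M :|: S)| + #|X :|: Y|.
  apply: leq_trans (leq_card_setU _ _); apply/subset_leq_card/subsetP=> c.
  by rewrite !inE; case: (label c == _); case: (c \in M); case: (c \in S);
    case: (c \in X); case: (c \in Y).
have [+ _] := leq_card_setU X Y; lia.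
Qed.

Lemma room_pick (M S : {set cell}) n k : room M S n.+1 -> k <= m ->
  exists X : {set cell}, [/\ X \subset pool, X \subset ~: (M :|: S) & #|X| = k].
Proof.
rewrite /room => le_z le_km.
have [|X sX cardX] := @exists_subset_card _ (pool :\: (M :|: S)) k.
  by have := cardsID (M :|: S) pool; rewrite card_pool mulnS in le_z *; lia.
exists X; split=> //; apply: subset_trans sX _; first exact: subsetDl.
by rewrite setDE subsetIr.
Qed.

Lemma linkedS (M M' : {set cell}) x y i : M \subset M' ->
  linked M x y i -> linked M' x y i.
Proof.
move=> sMM' /and4P[lti o1 o2 g]; apply/and4P; split=> //.
- exact: subset_trans sMM'.
- exact: subset_trans sMM'.
- exact: meetsS g.
Qed.

Lemma force_pool x y i n M S : linked M x y i ->
  zeta x <= #|M :&: pool| + m * n -> room M S n ->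
  dom_forces (claims_small win (set_size x)) m b n M S.
Proof.
elim: n M S => [|n IHn] M S lnk le_zeta rm /=.
  by left; apply: linked_small lnk _; lia.
right; have [X [Xpool Xfree cardX]] := room_pick rm (leqnn m).
exists X => [|Y /andP[_ leY]]; first by rewrite /legal_move Xfree cardX /=.
apply: IHn; [exact: linkedS (subsetUl _ _) lnk| |by apply: room_step; rewrite ?cardX].
apply: leq_trans le_zeta _; rewrite mulnS addnA leq_add2r.
rewrite setIUl (setIidPl Xpool) cardsU cardX (_ : M :&: pool :&: X = set0) ?cards0 ?subn0 //.
apply/setP=> c; rewrite !inE; apply/andP=> -[/andP[cM _] /(subsetP Xfree)].
by rewrite !inE cM.
Qed.

Lemma force_guard x y i n (M S : {set cell}) : i < L x ->
  blk (node x y i) \subset M -> blk (node x y i.+1) \subset M ->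
  ~~ (grd (edge x y i) \subset S) -> zeta x < m * n -> room M S n ->
  dom_forces (claims_small win (set_size x)) m b n M S.
Proof.
case: n => [|n] lti o1 o2 /subsetPn[g gg gS] lt_zeta rm; first by rewrite muln0 in lt_zeta.
have [X [Xpool Xfree cardX]] := room_pick rm (leq_pred m).
pose X' := ([set g] :\: M) :|: X.
have leX' : #|X'| <= m.
  rewrite /X'; have [+ _] := leq_card_setU ([set g] :\: M) X; rewrite cardX.
  by have := subset_leq_card (subsetDl [set g] M); rewrite cards1; lia.
right; exists X' => [|Y /andP[_ leY]].
  rewrite /legal_move leX' andbT subUset Xfree andbT.
  apply/subsetP=> c; rewrite !inE => /andP[cM /eqP eqc].
  by rewrite negb_or cM eqc.
apply: (@force_pool x y i) (room_step rm leX' leY).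
  apply/and4P; split=> //; first exact: (subset_trans o1 (subsetUl _ _)).
    exact: (subset_trans o2 (subsetUl _ _)).
  by apply/meetsP; exists g => //; rewrite !inE eqxx andbT; case: (g \in M).
suff : #|X| <= #|(M :|: X') :&: pool| by rewrite mulnS in lt_zeta; lia.
by apply: subset_leq_card; rewrite subsetI Xpool andbT /X' setUA subsetUr.
Qed.

Definition clear (S : {set cell}) x y i j : Prop :=
  (forall k, i < k < j -> ~~ meets (blk (node x y k)) S) /\
  (forall k, i <= k < j -> ~~ meets (grd (edge x y k)) S).

Definition within x y i j (c : cell) : Prop :=
  (exists2 k, i < k < j & c \in blk (node x y k)) \/
  (exists2 k, i <= k < j & c \in grd (edge x y k)).

Lemma clear_reply (S Y : {set cell}) x y i j : clear S x y i j ->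
  (forall c, c \in Y -> ~ within x y i j c) -> clear (S :|: Y) x y i j.
Proof.
move=> [cn cg] away; split=> k kij; rewrite meets_setU negb_or.
  rewrite cn //=; apply/negP=> /meetsP[c cv /away]; apply.
  by left; exists k.
by rewrite cg //=; apply/negP=> /meetsP[c cv /away]; apply; right; exists k.
Qed.

Lemma clear_sub S x y i j i' j' : i <= i' -> j' <= j ->
  clear S x y i j -> clear S x y i' j'.
Proof. by move=> lei lej [cn cg]; split=> k kij; [apply: cn|apply: cg]; lia. Qed.

Lemma within_split x y i p j c : p <= j <= L x ->
  within x y i p c -> ~ within x y p j c.
Proof.
move=> p_in [] [k k_in ck] [] [k' k'_in]; rewrite inE in ck; rewrite inE (eqP ck).
- have ltk : 0 < k < L x by lia.
  have lek' : k' <= L x by lia.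
  by move/eqP=> -[] /(node_in_inj ltk lek')[]; lia.
- by move/eqP.
- by move/eqP.
- have ltk : k < L x by lia.
  have ltk' : k' < L x by lia.
  move/eqP=> [eqk].
  by have [_ _] := @edge_inj x y k x y k' ltk ltk' (congr1 (pair (x, y)) eqk); lia.
Qed.

Lemma force_segment x y n k (M S : {set cell}) i : i + reach k <= L x ->
  blk (node x y i) \subset M -> blk (node x y (i + reach k)) \subset M ->
  clear S x y i (i + reach k) -> zeta x < m * n -> room M S (k + n) ->
  dom_forces (claims_small win (set_size x)) m b (k + n) M S.
Proof.
move=> + + + + lt_zeta; elim: k M S i => [|k IHk] M S i.
  have -> : reach 0 = 1 by rewrite /reach; case: ifP.
  rewrite addn1 => ltiL o1 o2 [_ cg] rm.
  apply: (force_guard ltiL o1 o2 _ lt_zeta rm).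
  apply/negP=> /subsetP sub; have [c cgi] : exists c, c \in grd (edge x y i).
    by apply/set0Pn; rewrite -card_gt0 card_grd.
  have i_in : i <= i < i.+1 by rewrite leqnn ltnSn.
  by case/negP: (cg i i_in); apply/meetsP; exists c => //; apply: sub.
set p := i + reach k; set j := i + reach k.+1 => lejL oi oj clr rm.
have ltpj : p < j by rewrite /p /j /reach expnS; have := expn_gt0 2 k; case: ifP; lia.
have ltip : i < p by rewrite /p /reach; have := expn_gt0 2 k; case: ifP; lia.
pose X := blk (node x y p) :\: M.
have leX : #|X| <= m by rewrite -(card_blk (node x y p)) subset_leq_card ?subsetDl.
right; exists X => [|Y lY].
  rewrite /legal_move leX andbT; apply/subsetP=> c; rewrite !inE => /andP[cM cv].
  rewrite negb_or cM; apply/negP=> cS; case: clr => /(_ p) + _; rewrite ltip ltpj.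
  by move/(_ isT)/negP=> []; apply/meetsP; exists c => //; rewrite inE.
have leY : #|Y| <= b by case/andP: lY.
have rm' : room (M :|: X) (S :|: Y) (k + n) by apply: room_step leX leY.
have op : blk (node x y p) \subset M :|: X.
  by apply/subsetP=> c cv; rewrite !(in_setU, in_setD) cv andbT orbN.
have oi' := subset_trans oi (subsetUl M X); have oj' := subset_trans oj (subsetUl M X).
case: (pselect (exists2 c, c \in Y & within x y i p c)) => [[c cY cin]|away]; last first.
  apply: (IHk _ _ i) => //; first by rewrite -/p; lia.
  apply: clear_reply; first by apply: clear_sub clr; rewrite -/p; lia.
  by move=> c cY cin; apply: away; exists c.
case: (eqVneq b 1) => [b1|b_neq1].
  have ejp : j = p + reach k by rewrite /j /p /reach b1 eqxx expnS; lia.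
  apply: (IHk _ _ p) => //; rewrite -?ejp //.
  apply: clear_reply; first by apply: clear_sub clr; lia.
  move=> d dY; suff -> : d = c by apply: within_split cin; lia.
  by apply/eqP; apply: contraTT leY => neq; rewrite b1 -ltnNge (cardsD1 c) cY
    (cardsD1 d) !inE neq dY.
have ejp : j = p.+1 by rewrite /j /p /reach (negPf b_neq1); lia.
apply: (force_guard (i := p) (y := y) _ op) rm'; rewrite -?ejp //.
  apply/negP=> /subsetP sub; suff : grd (edge x y p) \subset Y :\ c.
    move/subset_leq_card; rewrite card_grd.
    by have := cardsD1 c Y; rewrite cY; lia.
  apply/subsetP=> d dg; rewrite !inE; apply/andP; split.
    apply/eqP=> eqd; apply: (within_split (p := p) (j := j) _ cin); first by lia.
    by right; exists p; [lia|rewrite -eqd].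
  move: (sub d dg); rewrite inE => /orP[dS|//]; case: clr => _ /(_ p).
  by rewrite (ltnW ltip) ltpj => /(_ isT)/negP[]; apply/meetsP; exists d.
by apply: leq_trans lt_zeta _; rewrite leq_mul2l leq_addl orbT.
Qed.

Definition cycle_of (c : cell) : option 'I_b.+1 :=
  match label c with
  | inl (inl (_, y, _)) | inl (inr (_, y, _)) => Some y
  | inr _ => None
  end.

Lemma force_component x n k (M S : {set cell}) : L x = reach k ->
  ~~ meets (blk (root x)) S -> (forall y, clear S x y 0 (L x)) ->
  zeta x < m * n -> room M S (k.+1 + n) ->
  dom_forces (claims_small win (set_size x)) m b (k.+1 + n) M S.
Proof.
move=> eqL fresh clr lt_zeta rm; pose X := blk (root x) :\: M.
have leX : #|X| <= m by rewrite -(card_blk (root x)) subset_leq_card ?subsetDl.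
right; exists X => [|Y lY].
  rewrite /legal_move leX andbT; apply/subsetP=> c; rewrite !inE => /andP[cM cv].
  rewrite negb_or cM; apply: contra fresh => cS.
  by apply/meetsP; exists c => //; rewrite inE.
have leY : #|Y| <= b by case/andP: lY.
have [y miss] := missed_value cycle_of (@inj_id _) leY.
have orr : blk (root x) \subset M :|: X.
  by apply/subsetP=> c cv; rewrite !(in_setU, in_setD) cv andbT orbN.
have := @force_segment x y n k (M :|: X) (S :|: Y) 0.
rewrite add0n -eqL node0 nodeL leqnn; apply=> //; last exact: room_step rm leX leY.
apply: clear_reply => // c cY cin; apply: (miss c cY).
case: cin => -[k' k'_in]; rewrite inE /cycle_of; last by move/eqP->.
by rewrite node_in // => /eqP->.
Qed.

Definition component_of (c : cell) : option 'I_b.+2 :=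
  match label c with
  | inl (inl (x, _, _)) | inl (inr (x, _, _)) => Some x
  | inr _ => None
  end.

Lemma force_untouched x n k (S : {set cell}) : L x = reach k ->
  (forall c, c \in S -> component_of c <> Some x) ->
  zeta x < m * n -> room set0 S (k.+1 + n) ->
  dom_forces (claims_small win (set_size x)) m b (k.+1 + n) set0 S.
Proof.
move=> eqL miss; apply: force_component => // [|y].
  by apply/negP=> /meetsP[c]; rewrite inE => /eqP cE /miss; rewrite /component_of cE.
split=> k' k'_in; apply/negP=> /meetsP[c]; rewrite inE => /eqP cE /miss;
  rewrite /component_of cE //.
by rewrite node_in.
Qed.

(** * The values of the game *)

Section Values.

Variables (K q : 'I_b.+2 -> nat) (s s' t t' : nat).
Hypotheses (L_reach : forall x, L x = reach (K x)).
Hypotheses (zeta_lt : forall x, zeta x < m * q x)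
  (q_min : forall x n, zeta x < m * n -> q x <= n).
Hypotheses (le_ss' : s <= s') (le_tt' : t <= t') (le_z : b + (m + b) * (t + t') <= z).
Hypothesis size_val : forall x, set_size x = if x == ord0 then s else s'.
Hypothesis time_val : forall x, (K x).+1 + q x = if x == ord0 then t else t'.

Lemma reach_gt0 k : 0 < reach k.
Proof. by rewrite /reach; case: ifP; rewrite ?expn_gt0. Qed.

Lemma ltn_reach k : k < reach k.
Proof. by rewrite /reach; case: ifP => _; [apply: ltn_expl|apply: ltnSn]. Qed.

Lemma reach_mono k k' : k <= k' -> reach k <= reach k'.
Proof. by move=> le; rewrite /reach; case: ifP; rewrite ?leq_exp2l. Qed.

Lemma reach_lt k k' : k < k' -> reach k < reach k'.
Proof. by move=> lt; rewrite /reach; case: ifP; rewrite ?ltn_exp2l. Qed.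

Lemma reach_split k l1 l2 : reach k.+1 < l1 + l2 -> l1 <= reach k -> l2 <= reach k ->
  [&& 1 < b, 1 < l1 & 1 < l2].
Proof.
rewrite /reach; case: eqP => [_|/eqP b_neq1]; first by rewrite expnS; lia.
have b_gt1 : 1 < b by rewrite ltn_neqAle eq_sym b_neq1.
by move=> lt le1 le2; apply/and3P; split=> //; lia.
Qed.

(* Staller keeps the claimed blocks of component x more than this far apart
   during the first K x block moves of Dominator, and gives up afterwards. *)
Definition time_theta x j : nat := if j <= K x then reach (K x - j) else 0.

Definition lost_theta (lost : pred 'I_b.+2) (theta : 'I_b.+2 -> nat -> nat) x j :=
  if lost x then L x else theta x j.

Definition admissible (theta : 'I_b.+2 -> nat -> nat) : Prop :=
  [/\ forall x j, theta x j.+1 <= theta x j, forall x j, theta x j.+1 < L x &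
      forall x j l1 l2, theta x j < l1 + l2 -> 0 < l1 -> 0 < l2 ->
        l1 <= theta x j.+1 -> l2 <= theta x j.+1 -> [&& 1 < b, 1 < l1 & 1 < l2]].

Lemma admissible0 : admissible (fun _ _ => 0).
Proof.
split=> // [x _|x _ l1 l2 _]; first by have := L_gt1 x; lia.
by case: l1.
Qed.

Lemma admissible_time : admissible time_theta.
Proof.
split=> [x j|x j|x j l1 l2]; rewrite /time_theta.
- case: (ltnP j (K x)) => // ltj; rewrite (ltnW ltj); apply: reach_mono; lia.
- rewrite L_reach; case: (ltnP j (K x)) => [ltj|_]; last exact: reach_gt0.
  by apply: reach_lt; lia.
case: (ltnP j (K x)) => [ltj|_]; last by case: l1.
rewrite (ltnW ltj) -[K x - j]prednK ?subn_gt0 // -subnS => lt _ _.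
exact: reach_split lt.
Qed.

Lemma not_forced theta (lost : pred 'I_b.+2) (goal : {set cell} -> Prop) N S :
  admissible theta -> (forall x, lost x -> meets (blk (root x)) S) ->
  (forall j1 j2 (M : {set cell}), j1 + j2 <= N -> ~~ (small_set \subset M) ->
     (forall x y i, linked M x y i ->
        [/\ ~~ lost x, theta x j1 = 0 &
            forall k, k <= #|M :&: pool| -> k < m * j2]) -> ~ goal M) ->
  ~ dom_forces goal m b N set0 S.
Proof.
move=> [anti lt_root split_] lostP safe.
apply: (@staller_survives (lost_theta lost theta) lost) (leqnn N) => //.
- by move=> x j; rewrite /lost_theta; case: ifP.
- by move=> x j; rewrite /lost_theta => /negPf->.
- move=> x j l1 l2; rewrite /lost_theta; case: ifP => _ lt le; last exact: split_ lt.
  by rewrite ltnNge le in lt.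
move=> j1 j2 M S' I le_jN; apply: (safe _ _ _ le_jN (inv_not_small I)) => x y i lnk.
have := inv_linked I lnk; rewrite /lost_theta; case: ifP => [_ L0|_ th0].
  by have := L_gt1 x; rewrite L0.
by split=> // k lek; apply: inv_loose_ge I lnk lek.
Qed.

Lemma size_ge (W M : {set cell}) : win W -> W \subset M -> ~~ (small_set \subset M) ->
  exists x y i, linked M x y i /\ set_size x <= #|W|.
Proof.
move=> /winP[sW|[x [y [i [lnk le]]]]] sWM nsm.
  by case/negP: nsm; apply: subset_trans sWM.
by exists x, y, i; split; [exact: linkedS sWM lnk|exact: linked_card lnk le].
Qed.

Lemma room0 (Y : {set cell}) n : #|Y| <= b -> n <= t + t' -> room set0 Y n.
Proof.
move=> leY len; rewrite /room set0U; apply: leq_trans le_z; apply: leq_add.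
  exact: leq_trans (subset_leq_card (subsetIr _ _)) leY.
by rewrite leq_mul2l len orbT.
Qed.

Lemma board_dstart : forces_dstart (claims_small win s) m b t.
Proof.
have := size_val ord0; have := time_val ord0; rewrite eqxx => eqt <-; rewrite -eqt.
apply: force_untouched => //; first by move=> c; rewrite inE.
by apply: room0; rewrite ?cards0 // eqt leq_addr.
Qed.

Lemma board_sstart : forces_sstart (claims_small win s') m b t'.
Proof.
move=> Y /andP[_ leY]; have [u miss] := missed_value component_of (@lift_inj _ ord0) leY.
have := size_val (lift ord0 u); have := time_val (lift ord0 u).
have -> : (lift ord0 u == ord0) = false by apply/negbTE; rewrite eq_sym neq_lift.
move=> eqt <-; rewrite -eqt; apply: force_untouched => //.
by apply: room0; rewrite // eqt leq_addl.
Qed.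

Lemma board_size_dstart n l : l < s -> ~ forces_dstart (claims_small win l) m b n.
Proof.
move=> lt_ls; apply: (not_forced (lost := pred0) admissible0) => //.
move=> j1 j2 M _ nsm _ [W [wW sWM leW]].
have [x [y [i [_]]]] := size_ge wW sWM nsm.
by rewrite size_val; case: ifP; lia.
Qed.

Lemma board_time_dstart n : n < t -> ~ forces_dstart (fun D => win D) m b n.
Proof.
move=> lt_nt; apply: (not_forced (lost := pred0) admissible_time) => //.
move=> j1 j2 M le_jn nsm lnkP /winP[|[x [y [i [lnk le]]]]]; first by rewrite (negPf nsm).
have [_ th0 /(_ _ le)/q_min le_q] := lnkP _ _ _ lnk.
have := time_val x; move: th0; rewrite /time_theta.
case: leqP => [_ r0|]; first by have := reach_gt0 (K x - j1); rewrite r0.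
by case: ifP; lia.
Qed.

Lemma not_sstart (goal : {set cell} -> Prop) n :
  (forall c, c \in blk (root ord0) -> ~ dom_forces goal m b n set0 [set c]) ->
  ~ forces_sstart goal m b n.
Proof.
move=> not_forced_c; have [c cr] := blk_cell (root ord0).
move/(_ [set c]) => forced; apply: (not_forced_c c cr); apply: forced.
by rewrite /legal_move cards1 b_gt0 setU0 setC0 subsetT.
Qed.

Lemma board_size_sstart n l : l < s' -> ~ forces_sstart (claims_small win l) m b n.
Proof.
move=> lt_ls; apply: not_sstart => c cr.
apply: (not_forced (lost := pred1 ord0) admissible0).
  by move=> x /= /eqP->; apply/meetsP; exists c; rewrite ?set11.
move=> j1 j2 M _ nsm lnkP [W [wW sWM leW]].
have [x [y [i [lnk]]]] := size_ge wW sWM nsm.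
have [/= /negPf x0 _ _] := lnkP _ _ _ lnk.
by rewrite size_val x0 => /leq_trans/(_ leW); rewrite leqNgt lt_ls.
Qed.

Lemma board_time_sstart n : n < t' -> ~ forces_sstart (fun D => win D) m b n.
Proof.
move=> lt_nt; apply: not_sstart => c cr.
apply: (not_forced (lost := pred1 ord0) admissible_time).
  by move=> x /= /eqP->; apply/meetsP; exists c; rewrite ?set11.
move=> j1 j2 M le_jn nsm lnkP /winP[|[x [y [i [lnk le]]]]]; first by rewrite (negPf nsm).
have [/= /negPf x0 th0 /(_ _ le)/q_min le_q] := lnkP _ _ _ lnk.
have := time_val x; rewrite x0; move: th0; rewrite /time_theta.
case: leqP => [_ r0|]; first by have := reach_gt0 (K x - j1); rewrite r0.
lia.
Qed.

Lemma board_graph : m + e <= s ->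
  exists G : sgraph,
    [/\ domination_number G = m + e,
        sMB G m b = Some s,
        gammaMB G m b = Some t,
        sMB' G m b = Some s' &
        gammaMB' G m b = Some t'].
Proof.
move=> le_rs; apply: (@realise_game _ win) => //.
- exact: win_mono.
- by rewrite addn_gt0 m_gt0.
- by exists small_set; [apply/winP; left|apply: card_small_set].
- move=> W /winP[/subset_leq_card|[x [y [i [lnk le]]]]]; first by rewrite card_small_set.
  apply: leq_trans (linked_card lnk le); rewrite size_val.
  by case: ifP => _ //; apply: leq_trans le_ss'.
- exact: board_dstart.
- exact: board_sstart.
- exact: board_size_dstart.
- exact: board_size_sstart.
- exact: board_time_dstart.
- exact: board_time_sstart.
Qed.

End Values.

End Board.

Lemma ceil_div_ge a d : 0 < d -> a <= d * ceil_div a d.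
Proof.
move=> d_gt0; rewrite /ceil_div; have := ltn_ceil (a + d.-1) d_gt0.
by rewrite mulSn; lia.
Qed.

Lemma ceil_div_le a d n : 0 < d -> a <= d * n -> ceil_div a d <= n.
Proof.
by move=> d_gt0 le; rewrite /ceil_div -ltnS ltn_divLR // mulSn mulnC; lia.
Qed.

Theorem theorem1p4 (m b r s s' t t' : nat)
  (hm : 0 < m) (hb : 0 < b) (hr : 0 < r) (hs : 0 < s) (hs' : 0 < s')
  (ht : 0 < t) (ht' : 0 < t')
  (hss' : s <= s') (hsmax : maxn r (2 * m + 1) <= s)
  (hmmin : m <= minn b (r - 1))
  (htt' : t <= t') (hts : ceil_div s m <= t) (hts' : ceil_div s' m <= t') :
  exists G : sgraph,
    [/\ domination_number G = r,
        sMB G m b = Some s,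
        gammaMB G m b = Some t,
        sMB' G m b = Some s' &
        gammaMB' G m b = Some t'].
Proof.
have [le_rs le_ms] : r <= s /\ 2 * m + 1 <= s by lia.
have [le_mb lt_mr] : m <= b /\ m < r by lia.
pose sz (x : 'I_b.+2) := if x == ord0 then s else s'.
pose tm (x : 'I_b.+2) := if x == ord0 then t else t'.
pose q x := ceil_div (sz x - 2 * m) m.
pose K x := (tm x - q x).-1.
have le_sz x : 2 * m + 1 <= sz x by rewrite /sz; case: ifP; lia.
have le_tm x : q x + 2 <= tm x.
  have -> : q x + 2 = ceil_div (sz x) m.
    by rewrite /q /ceil_div addnC -divnMDl //; congr (_ %/ _); have := le_sz x; lia.
  by rewrite /sz /tm; case: ifP.
have r_eq : r = m + (r - m) by lia.
rewrite r_eq; apply: (@board_graph m b (\max_x reach b (K x))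
  (b + (m + b) * (t + t')) (r - m) (fun x => reach b (K x))
  (fun x => sz x - (2 * m + 1)) hm le_mb _ _ _ K q) => //; try lia.
- move=> x; apply: leq_trans (_ : K x < _); first by rewrite /K; have := le_tm x; lia.
  exact: ltn_reach.
- by move=> x; apply: leq_bigmax.
- move=> x; have := ceil_div_ge (sz x - 2 * m) hm; rewrite -/(q x).
  by have := le_sz x; lia.
- move=> x n lt; apply: ceil_div_le => //; have := le_sz x; lia.
- by move=> x; rewrite /set_size; have := le_sz x; rewrite /sz; lia.
- by move=> x; rewrite /K; have := le_tm x; rewrite /tm; lia.
Qed.
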